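(* Let $(\Omega,\rho)$ and $(Y,\mu)$ be $\sigma$-finite measure spaces, let $w$ be in $\mathcal{L}^1(Y,\mu)$, let $\mathcal{X} = L^q(\Omega,\rho)$, $q \in [1,\infty)$, be separable, and let $\phi: \Omega \times Y \to \mathbb{R}$ be $\rho \times \mu$-measurable. Let $\Phi: Y \to \mathcal{X}$ be defined for each $y$ in $Y$ by $\Phi(y)(x) := \phi(x,y)$ for $\rho$-a.e. $x \in \Omega$, and suppose that for some $M < \infty$, $\|\Phi(y)\|_{\mathcal{X}} \leq M$ for $\mu$-a.e. $y$. Then the following hold: (i) For $\rho$-a.e. $x \in \Omega$, the integral $\int_Y w(y) \phi(x,y)\,d\mu(y)$ exists and is finite. (ii) The function $f$ defined by $$f(x) = \int_Y w(y) \phi(x,y)\,d\mu(y)$$ is in $\mathcal{L}^q(\Omega, \rho)$ and its equivalence class, also denoted by $f$, is in $L^q(\Omega, \rho) = \mathcal{X}$ and satisfies $$\|f\|_{\mathcal{X}} \leq \|w\|_{L^1(Y,\mu)}\,M.$$ (iii) The function $\Phi$ is measurable and hence in $\mathcal{L}^\infty(Y,\mu;\mathcal{X})$, and $f$ is the Bochner integral of $w\Phi$ with respect to $\mu$, i.e., $$f = \mathcal{B}\text{-}\int_Y (w \Phi)(y)\, d\mu(y).$$ (iv) For $G = \{\Phi(y) : y\in Y,\ \|\Phi(y)\|_{\mathcal{X}} \leq \|\Phi\|_{L^\infty(Y,\mu; \mathcal{X})} \}$, $f$ is in $\mathcal{X}_G$, and $$\|f\|_{G,\mathcal{X}} \leq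 \|w\|_{L^1(Y,\mu)}$$ and $$\|f\|_{\mathcal{X}} \leq \|f\|_{G,\mathcal{X}}\, s_{G,\mathcal{X}} \leq \|w\|_{L^1(Y,\mu)} \|\Phi\|_{L^\infty(Y,\mu;\mathcal{X})}.$$
   Context: All linear spaces are over $\mathbb{R}$ and functions are real-valued unless stated otherwise. $\mathcal{L}^q$ denotes the space of functions and $L^q$ the space of equivalence classes modulo a.e. equality. $\rho\times\mu$-measurability refers to the product $\sigma$-algebra generated by measurable rectangles. A function from a measure space to a topological space is measurable if preimages of open sets are measurable. $(w\Phi)(y) := w(y)\Phi(y)$. Bochner integration. Let $(Y,\mu)$ be a measure space and $\mathcal{X}$ a Banach space. A function $s:Y\to\mathcal{X}$ is simple if it takes finitely many nonzero values $f_1,\dots,f_m$, with $f_j$ taken exactly on a measurable set $P_j$ with $\mu(P_j)<\infty$, the $P_j$ pairwise disjoint; put $I(s,\mu)=\sum_j\mu(P_j)f_j$. A function $h:Y\to\mathcal{X}$ is strongly measurable if it is the $\mu$-a.e. limit (in the norm of $\mathcal{X}$) of a sequence of simple functions. It is Bochner integrable if it is strongly measurable and there are simple functions $s_k$ with $\int_Y\|s_k(y)-h(y)\|_{\mathcal{X}}\,d\mu(y)\to0$; then its Bochner integral is $\mathcal{B}\text{-}\int_Y h(y)\,d\mu(y):=\lim_k I(s_k,\mu)\in\mathcal{X}$, independent of the choice of $(s_k)$. $\mathcal{L}^\infty(Y,\mu;\mathcal{X})$ is the space of strongly measurable functions $h:Y\to\mathcal{X}$ that are essentially bounded, i.e.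 for which there is a $\mu$-null set $N$ with $\sup_{y\in Y\setminus N}\|h(y)\|_{\mathcal{X}}<\infty$. Its quotient by a.e. equality is $L^\infty(Y,\mu;\mathcal{X})$, with norm $\|h\|_{L^\infty(Y,\mu;\mathcal{X})}:=\inf\{B\ge0:\ \text{there is a } \mu\text{-null } N\subset Y \text{ with } \|h(y)\|_{\mathcal{X}}\le B \text{ for all } y\in Y\setminus N\}$. $G$-variation. For a (nonempty) subset $G$ of a normed linear space $\mathcal{X}$, let $s_{G,\mathcal{X}}:=\sup_{g\in G}\|g\|_{\mathcal{X}}$, let $\pm G:=G\cup -G$, and let $B_{G,\mathcal{X}}$ be the closure in $\mathcal{X}$ of the convex hull of $\pm G$. Put $\mathcal{X}_G:=\{f\in\mathcal{X}:\exists\lambda>0,\ f/\lambda\in B_{G,\mathcal{X}}\}$ and $\|f\|_{G,\mathcal{X}}:=\inf\{\lambda>0: f/\lambda\in B_{G,\mathcal{X}}\}$. *)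

(* Defs.v *)
From HB Require Import structures.
From mathcomp Require Import all_boot all_order all_algebra.
From mathcomp Require Import all_classical all_reals all_analysis.
From mathcomp Require Import measurable_realfun ess_sup_inf.

Set Implicit Arguments.
Unset Strict Implicit.
Unset Printing Implicit Defensive.

Import Order.TTheory GRing.Theory Num.Theory.
Import numFieldNormedType.Exports.

Local Open Scope classical_set_scope.
Local Open Scope ring_scope.

(** MathComp-Analysis defines the quotient [LspaceType mu p1] of the p-integrable
    functions by a.e. equality without any algebraic or normed structure; we
    equip it with the usual one.  An element of [LspaceType mu p1] coerces to a
    function by choice of a representative. *)

Section Lspace_class.
Context d (T : measurableType d) (R : realType).
Variables (mu : {measure set T -> \bar R}) (p : \bar R) (p1 : (1 <= p)%E).

Lemma ae_eq_Lnorm (f g : T -> R) :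
  measurable_fun setT f -> measurable_fun setT g -> f = g %[ae mu] ->
  'N[mu]_p[EFin \o f]%E = 'N[mu]_p[EFin \o g]%E.
Proof.
move=> mf mg fg; rewrite unlock /Lnorm.
case: p p1 => [r r1|_|//].
- congr (_ `^ _)%E; apply: ge0_ae_eq_integral => //.
  + apply/measurable_EFinP/(@measurableT_comp _ _ _ _ _ _ (@powR R ^~ r)) => //.
    exact: measurableT_comp.
  + apply/measurable_EFinP/(@measurableT_comp _ _ _ _ _ _ (@powR R ^~ r)) => //.
    exact: measurableT_comp.
  + by move=> x _; rewrite /= lee_fin powR_ge0.
  + by move=> x _; rewrite /= lee_fin powR_ge0.
  + by apply: filterS fg => x + _ => /(_ I) /= ->.
- case: ifPn => // mu0; apply: eq_ess_sup.
  by apply: filterS fg => x /(_ I) /= ->.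
Qed.

(* [LspaceType] is built with [measurableTypeR R], which has the same measurable
   sets as the canonical measurable structure of [R] but another display. *)
Let mfunR (f : T -> R) (hf : f \in Lfun mu p) :
    measurable_fun setT (f : T -> measurableTypeR R).
Proof. exact: (set_mem (sub_Lfun_mfun hf)). Qed.

Let mfun_of (f : T -> R) (hf : f \in Lfun mu p) :
    {mfun T >-> measurableTypeR R} :=
  MeasurableFun.Pack (MeasurableFun.Class
    (@isMeasurableFun.Build _ _ T (measurableTypeR R) f (mfunR hf))).

Let mclass (f : T -> R) (hf : f \in Lfun mu p) :
    @aeEqMfun _ _ _ T (measurableTypeR R) mu :=
  \pi_(@aeEqMfun _ _ _ T (measurableTypeR R) mu)%qT (mfun_of hf).

Let mclassE f hf : (@mclass f hf : T -> R) = f %[ae mu].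
Proof.
have /eqP := reprK (@mclass f hf).
by rewrite {2}/mclass eqmodE => /asboolP.
Qed.

Let mclass_finite f hf : finite_norm mu p (@mclass f hf).
Proof.
have /andP[/set_mem mf /set_mem fin] := hf.
rewrite /finite_norm (@ae_eq_Lnorm _ f) //.

exact: (@measurable_funPT _ _ _ _ (repr (mclass hf))).
Qed.

Definition Lclass (f : T -> R) (hf : f \in Lfun mu p) : LspaceType mu p1 :=
  LebesgueSpace.Pack (LebesgueSpace.Class
    (isFinLebesgue.Build d T R mu p p1 (mclass hf) (mclass_finite hf))).

Lemma LclassE f (hf : f \in Lfun mu p) : (Lclass hf : T -> R) = f %[ae mu].
Proof. exact: mclassE. Qed.

Lemma Lspace_Lfun (F : LspaceType mu p1) : (F : T -> R) \in Lfun mu p.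
Proof.
apply/andP; split; apply: mem_set; last exact: Lebesgue_finite.
exact: (@measurable_funPT _ _ _ _ (repr (LebesgueSpace.sort F))).
Qed.

Lemma Lspace_eqP (F G : LspaceType mu p1) :
  (F : T -> R) = G %[ae mu] <-> F = G.
Proof.
split=> [FG|->]; last exact: aeW.
have : LebesgueSpace.sort F = LebesgueSpace.sort G.
  apply/eqP; rewrite -[LebesgueSpace.sort F]reprK -[LebesgueSpace.sort G]reprK.
  by rewrite eqmodE; exact/asboolP.
case: F G {FG} => f [[Ff]] [g [[Fg]]] /= fg; subst g.
by rewrite (Prop_irrelevance Ff Fg).
Qed.

HB.instance Definition _ := gen_eqMixin (LspaceType mu p1).
HB.instance Definition _ := gen_choiceMixin (LspaceType mu p1).

Let closed := @Lfun_submod_closed _ _ _ mu p p1.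

Let Lfun_0 : (cst 0 : T -> R) \in Lfun mu p.
Proof. exact: closed.1. Qed.

Let Lfun_lin a (f g : T -> R) : f \in Lfun mu p -> g \in Lfun mu p ->
  (fun x => a * f x + g x) \in Lfun mu p.
Proof. by move=> hf hg; have := closed.2 a _ _ hf hg. Qed.

Let Lfun_D (f g : T -> R) : f \in Lfun mu p -> g \in Lfun mu p ->
  f \+ g \in Lfun mu p.
Proof.
move=> hf hg; rewrite (_ : f \+ g = fun x => 1 * f x + g x) ?Lfun_lin//.
by apply/funext => x; rewrite mul1r.
Qed.

Let Lfun_Z a (f : T -> R) : f \in Lfun mu p -> a \*o f \in Lfun mu p.
Proof.
move=> hf; rewrite (_ : a \*o f = fun x => a * f x + cst 0 x) ?Lfun_lin//.
by apply/funext => x; rewrite addr0.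
Qed.

Let Lfun_N (f : T -> R) : f \in Lfun mu p -> \- f \in Lfun mu p.
Proof.
move=> hf; rewrite (_ : \- f = -1 \*o f) ?Lfun_Z//.
by apply/funext => x; rewrite /= mulN1r.
Qed.

Let L0 := Lclass Lfun_0.
Let LD (F G : LspaceType mu p1) := Lclass (Lfun_D (Lspace_Lfun F) (Lspace_Lfun G)).
Let LN (F : LspaceType mu p1) := Lclass (Lfun_N (Lspace_Lfun F)).
Let LZ a (F : LspaceType mu p1) := Lclass (Lfun_Z a (Lspace_Lfun F)).

Let L0E : (L0 : T -> R) = cst 0 %[ae mu]. Proof. exact: LclassE. Qed.
Let LDE F G : (LD F G : T -> R) = (F : T -> R) \+ G %[ae mu].
Proof. exact: LclassE. Qed.
Let LNE F : (LN F : T -> R) = \- (F : T -> R) %[ae mu].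
Proof. exact: LclassE. Qed.
Let LZE a F : (LZ a F : T -> R) = a \*o (F : T -> R) %[ae mu].
Proof. exact: LclassE. Qed.

Let addA : associative LD.
Proof.
move=> F G H; apply/Lspace_eqP.
apply: filterS2 (filterI (LDE F (LD G H)) (LDE G H))
  (filterI (LDE (LD F G) H) (LDE F G)) => x [h1 h2] [h3 h4] _.
by rewrite h1//= h2//= h3//= h4//= addrA.
Qed.

Let addC : commutative LD.
Proof.
move=> F G; apply/Lspace_eqP.
by apply: filterS2 (LDE F G) (LDE G F) => x h1 h2 _; rewrite h1//= h2//= addrC.
Qed.

Let add0 : left_id L0 LD.
Proof.
move=> F; apply/Lspace_eqP.
by apply: filterS2 (LDE L0 F) L0E => x h1 h2 _; rewrite h1//= h2//= add0r.
Qed.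

Let addN : left_inverse L0 LN LD.
Proof.
move=> F; apply/Lspace_eqP.
apply: filterS3 (LDE (LN F) F) (LNE F) L0E => x h1 h2 h3 _.
by rewrite h1//= h2//= h3//= addNr.
Qed.

HB.instance Definition _ :=
  GRing.isZmodule.Build (LspaceType mu p1) addA addC add0 addN.

Let scaleA a b F : LZ a (LZ b F) = LZ (a * b) F.
Proof.
apply/Lspace_eqP; apply: filterS3 (LZE a (LZ b F)) (LZE b F) (LZE (a * b) F).
by move=> x h1 h2 h3 _; rewrite h1//= h2//= h3//= mulrA.
Qed.

Let scale1 : left_id 1 LZ.
Proof.
move=> F; apply/Lspace_eqP.
by apply: filterS (LZE 1 F) => x h1 _; rewrite h1//= mul1r.
Qed.

Let scaleDr : right_distributive LZ +%R.
Proof.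
move=> a F G; apply/Lspace_eqP.
apply: filterS3 (filterI (LZE a (LD F G)) (LDE F G))
  (LDE (LZ a F) (LZ a G)) (filterI (LZE a F) (LZE a G)) =>
  x [h1 h2] h3 [h4 h5] _.
by rewrite h1//= h2//= h3//= h4//= h5//= mulrDr.
Qed.

Let scaleDl F : {morph LZ^~ F : a b / a + b}.
Proof.
move=> a b; apply/Lspace_eqP.
apply: filterS2 (filterI (LZE (a + b) F) (LDE (LZ a F) (LZ b F)))
  (filterI (LZE a F) (LZE b F)).
by move=> x [h1 h2] [h3 h4] _; rewrite h1//= h2//= h3//= h4//= mulrDl.
Qed.

HB.instance Definition _ := GRing.Zmodule_isLmodule.Build R (LspaceType mu p1)
  scaleA scale1 scaleDr scaleDl.

Let nrm (F : LspaceType mu p1) : R := fine 'N[mu]_p[EFin \o F]%E.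

Let mfunL (F : LspaceType mu p1) : measurable_fun setT (F : T -> R).
Proof. by have /andP[/set_mem] := Lspace_Lfun F. Qed.

Let nrmE F : ((nrm F)%:E = 'N[mu]_p[EFin \o F])%E.
Proof.
rewrite /nrm fineK// fin_numElt (lt_le_trans ltNy0) ?Lnorm_ge0//=.
exact: Lebesgue_finite.
Qed.

Let nrmD F G : nrm (F + G) <= nrm F + nrm G.
Proof.
rewrite -lee_fin EFinD !nrmE (@ae_eq_Lnorm _ ((F : T -> R) \+ G)) //.
- exact: eminkowski.
- exact: measurable_funD.
Qed.

Let nrmZ a F : nrm (a *: F) = `|a| * nrm F.
Proof.
apply: EFin_inj; rewrite EFinM !nrmE.
rewrite (@ae_eq_Lnorm _ (a \*o (F : T -> R))) //.
- exact: (LnormZ (Lfun_Sub p1 (Lspace_Lfun F)) a).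
- exact: measurable_funM.
Qed.

Let nrm0 F : nrm F = 0 -> F = 0.
Proof.
move=> nF; apply/Lspace_eqP.
have /Lnorm_eq0_eq0 : 'N[mu]_p[EFin \o F]%E = 0%E by rewrite -nrmE nF.
have mF : measurable_fun setT (EFin \o (F : T -> R)) by exact/measurable_EFinP.
move=> /(_ mF (lt_le_trans lte01 p1)) F0.
by apply: filterS2 F0 L0E => x /(_ I) [->] h _; rewrite h.
Qed.

HB.instance Definition _ := Lmodule_isNormed.Build R (LspaceType mu p1)
  nrmD nrmZ nrm0.

Lemma Lspace_normE (F : LspaceType mu p1) :
  (`|F|%:E = 'N[mu]_p[EFin \o F])%E.
Proof. exact: nrmE. Qed.

Lemma Lspace0E : ((0 : LspaceType mu p1) : T -> R) = cst 0 %[ae mu].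
Proof. exact: L0E. Qed.

Lemma LspaceDE (F G : LspaceType mu p1) :
  (F + G : T -> R) = (F : T -> R) \+ G %[ae mu].
Proof. exact: LDE. Qed.

Lemma LspaceNE (F : LspaceType mu p1) :
  (- F : T -> R) = \- (F : T -> R) %[ae mu].
Proof. exact: LNE. Qed.

Lemma LspaceZE a (F : LspaceType mu p1) :
  (a *: F : T -> R) = a \*o (F : T -> R) %[ae mu].
Proof. exact: LZE. Qed.

End Lspace_class.

Definition separable (X : topologicalType) :=
  exists2 D : set X, countable D & dense D.

Definition Borel_measurable d (Y : measurableType d) (Z : topologicalType)
    (h : Y -> Z) :=
  forall U : set Z, open U -> measurable (h @^-1` U).

Section Bochner.
Context d (Y : measurableType d) (R : realType) (X : normedModType R).
Variable mu : {measure set Y -> \bar R}.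
Implicit Types (h : Y -> X) (s : nat -> Y -> X).

Definition simple_function (t : Y -> X) :=
  finite_set (range t `\ 0) /\
  forall v, v != 0 ->
    measurable (t @^-1` [set v]) /\ (mu (t @^-1` [set v]) < +oo)%E.

Definition simple_integral (t : Y -> X) : X :=
  \sum_(v \in range t `\ 0) fine (mu (t @^-1` [set v])) *: v.

Definition strongly_measurable h :=
  exists2 s, (forall k, simple_function (s k)) &
    \forall y \ae mu, s k y @[k --> \oo] --> h y.

(** For [h] strongly measurable the integrand below is a.e. equal to a
    measurable function (it need not be measurable if [mu] is not complete);
    for such nonnegative functions the library's integral, a supremum over
    smaller simple functions, is the usual one. *)
Definition Bochner_approx h s :=
  (forall k, simple_function (s k)) /\
  (\int[mu]_y `|s k y - h y|%:E)%E @[k --> \oo] --> 0%E.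

Definition Bochner_integrable h :=
  strongly_measurable h /\ exists s, Bochner_approx h s.

(** [v] is the Bochner integral of [h]: the limit is required to be [v] for
    every choice of the approximating sequence. *)
Definition is_Bochner_integral h (v : X) :=
  Bochner_integrable h /\
  forall s, Bochner_approx h s -> simple_integral (s k) @[k --> \oo] --> v.

Definition in_Linfty h :=
  strongly_measurable h /\ exists B : R, \forall y \ae mu, `|h y| <= B.

(** This differs from [ess_sup mu] of the norm only when [mu] is zero, where the
    latter is [-oo]. *)
Definition Linfty_norm h : \bar R :=
  ereal_inf [set B%:E | B in [set B : R | 0 <= B /\ \forall y \ae mu, `|h y| <= B]].

(** The variation with respect to a set is only meaningful for nonempty sets (the
    convex hull of the empty set is empty).  The zero measure is the only case in
    which the set below can be empty. *)
Lemma le_Linfty_norm_neq0 h : mu setT != 0%E ->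
  [set h y | y in [set y | (`|h y|%:E <= Linfty_norm h)%E]] !=set0.
Proof.
move=> mu0; apply: contrapT => h0.
have le_ess : (ess_sup mu (fun y => `|h y|%:E) <= Linfty_norm h)%E.
  apply: ereal_inf_le_tmp => _ [B [_ hB] <-].
  by apply: filterS hB => y; rewrite lee_fin.
have : \forall y \ae mu, False.
  apply: filterS (ess_sup_ge mu (fun y => `|h y|%:E)) => y hy.
  by apply: h0; exists (h y), y => //=; exact: le_trans le_ess.
case=> N [mN N0 sN]; move/eqP: mu0; apply.
apply: (subset_measure0 measurableT mN _ N0) => //; by move=> y _; apply: sN.
Qed.

End Bochner.

Section variation.
Context (R : realType) (X : normedModType R).
Implicit Types (G : set X) (f : X).

Definition pm_set G : set X := G `|` [set - g | g in G].

Definition convex_hull (A : set X) : set X := smallest (@convex_set R X) A.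

Definition variation_ball G : set X := closure (convex_hull (pm_set G)).

Definition variation_space G : set X :=
  [set f | exists2 l : R, 0 < l & variation_ball G (l^-1 *: f)].

Definition variation_norm G f : \bar R :=
  ereal_inf [set l%:E | l in [set l : R | 0 < l /\ variation_ball G (l^-1 *: f)]].

Definition variation_sup G : \bar R := ereal_sup [set `|g|%:E | g in G].

End variation.

(* Main.v *)
(** Everything rests on Minkowski's integral inequality: the L^q norm of
    [x |-> \int `|psi (x, y)| dmu y] is at most the integral over [y] of the L^q
    norms of the sections [psi (_, y)].  For [psi (x, y) = w y * phi (x, y)] it
    gives (i) and (ii).  Subtracting from it a function
    [\sum_v u v y * v x] with finitely many [v] in L^q shows that [f] is within
    [\int `|w y *: Phi y - \sum_v u v y *: v| dmu y] of
    [\sum_v (\int u v) *: v].  When the [u v] are the indicators of the level sets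
    of a simple function this identifies [f] with the Bochner integral (iii).
    When they are [w] times such indicators and the [v] are taken in [G], the sum
    lies in [l] times the convex hull of [G `|` - G] for every
    [l >= \int `|w|], whence (iv).  In both cases the approximations are built
    by mapping a point to its nearest neighbour among the first terms of a
    dense sequence. *)
Require Import Defs.
From HB Require Import structures.
From mathcomp Require Import all_boot all_order all_algebra.
From mathcomp Require Import all_classical all_reals all_analysis.
From mathcomp Require Import measurable_realfun ess_sup_inf.
Set Implicit Arguments.
Unset Strict Implicit.
Unset Printing Implicit Defensive.
Import Order.TTheory GRing.Theory Num.Theory.
Import numFieldNormedType.Exports.
Local Open Scope classical_set_scope.
Local Open Scope ring_scope.

(** * Minkowski's integral inequality *)

Lemma ge0_le_poweR {R : realType} (r : R) (x y : \bar R) :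
  0 <= r -> (0 <= x)%E -> (x <= y)%E -> (x `^ r <= y `^ r)%E.
Proof.
move=> r0 x0 xy; apply: gt0_ler_poweR => //; rewrite in_itv/= leey andbT//.
exact: le_trans xy.
Qed.

Section Minkowski.
Context {R : realType} {dO dY : measure_display}.
Context {Omega : measurableType dO} {Y : measurableType dY}.
Variable rho : {sigma_finite_measure set Omega -> \bar R}.
Variable mu : {sigma_finite_measure set Y -> \bar R}.

(* Hoelder applied to [|f| = n `^ p^-1 * (|f| * n `^ - p^-1)], where p and q are
   conjugate. *)
Lemma powR_integral_le (n f : Y -> R) (q : R) :
  1 <= q -> measurable_fun setT n -> measurable_fun setT f ->
  (forall y, 0 <= n y) -> (forall y, n y = 0 -> f y = 0) ->
  ((\int[mu]_y `|f y|%:E) `^ q <=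
   (\int[mu]_y (n y)%:E) `^ (q - 1) *
   \int[mu]_y (`|f y| `^ q * n y `^ (1 - q))%:E)%E.
Proof.
move=> q1 mn mf n0 nf0.
have q0 : 0 < q by rewrite (lt_le_trans ltr01).
(* For [q = 1] the conjugate exponent is infinite; both sides are then the integral of [|f|]. *)
have [->|qneq1] := eqVneq q 1.
  rewrite subrr poweRe0 mul1e poweRe1; last first.
    by apply: integral_ge0 => y _; rewrite lee_fin.
  rewrite le_eqVlt; apply/orP; left; apply/eqP; apply: eq_integral => y _.
  by rewrite powRr0 mulr1 powRr1.
have qgt1 : 1 < q by rewrite lt_neqAle eq_sym qneq1.
have p0 : 0 < q - 1 by rewrite subr_gt0.
pose p := q / (q - 1).
have pgt0 : 0 < p by rewrite divr_gt0.
have pq : p^-1 + q^-1 = 1.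
  by rewrite /p invf_div -[X in _ + X]div1r -mulrDl subrK divff// gt_eqF.
pose a y := n y `^ p^-1.
pose b y := `|f y| * n y `^ (- p^-1).
have ma : measurable_fun setT a.
  exact: (measurableT_comp (measurable_powR _)).
have mb : measurable_fun setT b.
  apply: measurable_funM; first exact: measurableT_comp.
  exact: (measurableT_comp (measurable_powR _)).
have abE y : `|a y * b y| = `|f y|.
  (* The two powers of [n y] cancel only for [n y != 0]; at the other points [f y] vanishes. *)
  have [n00|nn0] := eqVneq (n y) 0.
    by rewrite /b nf0// normr0 mul0r mulr0 normr0.
  rewrite /a /b mulrCA -powRD; last by rewrite nn0 implybT.
  by rewrite subrr powRr0 mulr1 normr_id.
have := hoelder mu ma mb pgt0 q0 pq.
rewrite Lnorm1 (eq_integral (fun y => `|f y|%:E)); last first.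
  by move=> y _; rewrite /= abE.
move=> /(ge0_le_poweR (ltW q0)) => /(_ (integral_ge0 _ _)) h.
apply: le_trans (h _) _; first by move=> y _; rewrite lee_fin.
rewrite poweRM ?Lnorm_ge0// poweR_Lnorm ?gt_eqF//.
rewrite le_eqVlt; apply/orP; left; apply/eqP; congr (_ * _)%E.
  (* The [q]-th power of the L^p norm of [a] is the [q - 1] power of its [p]-th power, which is the
     integral of [n]. *)
  rewrite -[X in (_ `^ X)%E](_ : p * (q - 1) = q); last first.
    by rewrite /p divfK// gt_eqF.
  rewrite poweRrM poweR_Lnorm ?gt_eqF//; congr (_ `^ _)%E.
  apply: eq_integral => y _ /=; rewrite ger0_norm ?powR_ge0//.
  by rewrite /a -powRrM mulVf ?gt_eqF// powRr1.
apply: eq_integral => y _ /=.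
congr (_%:E).
rewrite ger0_norm ?mulr_ge0 ?powR_ge0// powRM ?powR_ge0// -powRrM.
by rewrite /p invf_div mulNr divfK ?gt_eqF// opprB.
Qed.

(** Apply [powR_integral_le] at each [x] with weight [n], integrate over [x] and exchange the
    integrals by Tonelli. The inner integral of [k] is at most [n y ^ q * n y ^ (1 - q) = n y], so
    the [q]-th power of the left side is at most [C ^ (q - 1) * C]. *)
Lemma Lnorm_integral_le_bound (n : Y -> R) (psi : Omega * Y -> R) (q : R) :
  1 <= q -> measurable_fun setT n -> measurable_fun setT psi ->
  (forall y, 0 <= n y) -> (forall x y, n y = 0 -> psi (x, y) = 0) ->
  (\int[mu]_y (n y)%:E < +oo)%E ->
  (forall y, 'N[rho]_q%:E[(fun x => (psi (x, y))%:E)] <= (n y)%:E)%E ->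
  ('N[rho]_q%:E[(fun x => \int[mu]_y `|psi (x, y)|%:E)] <=
    \int[mu]_y (n y)%:E)%E.
Proof.
move=> q1 mn mpsi n0 psi0 noo le_n.
have q0 : 0 < q by rewrite (lt_le_trans ltr01).
set C := (\int[mu]_y (n y)%:E)%E in noo *.
have C0 : (0 <= C)%E by apply: integral_ge0 => y _; rewrite lee_fin.
pose k xy := (`|psi xy| `^ q * n xy.2 `^ (1 - q))%:E.
have mk : measurable_fun setT k.
  apply/measurable_EFinP/measurable_funM.
    by apply: (measurableT_comp (measurable_powR _)); exact: measurableT_comp.
  apply: (measurableT_comp (measurable_powR _)).
  exact: measurableT_comp.
have k0 xy : (0 <= k xy)%E by rewrite lee_fin mulr_ge0// powR_ge0.
have mg : measurable_fun setT (fun x => \int[mu]_y `|psi (x, y)|%:E)%E.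
  apply: (@measurable_fun_fubini_tonelli_F _ _ _ _ _ mu (fun xy => `|psi xy|%:E)).
    by apply/measurable_EFinP; exact: measurableT_comp.
  by move=> xy; rewrite lee_fin.
have g0 x : (0 <= \int[mu]_y `|psi (x, y)|%:E)%E.
  by apply: integral_ge0 => y _; rewrite lee_fin.
suff h : (\int[rho]_x (\int[mu]_y `|psi (x, y)|%:E) `^ q <= C `^ q)%E.
  rewrite unlock/=; under eq_integral do rewrite gee0_abs//.
  rewrite -[leRHS]poweRe1// -(divff (lt0r_neq0 q0)) poweRrM.
  apply: ge0_le_poweR h; first by rewrite invr_ge0 ltW.
  by apply: integral_ge0 => x _; exact: poweR_ge0.
have psiE x : measurable_fun setT (fun y => psi (x, y)).
  exact: measurableT_comp.
apply: (@le_trans _ _ (\int[rho]_x (C `^ (q - 1) * \int[mu]_y k (x, y)))%E).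
  apply: ge0_le_integral => //.
  - by move=> x _; exact: poweR_ge0.
  - exact: (measurableT_comp (measurable_poweR _)).
  - apply: emeasurable_funM => //.
    exact: (measurable_fun_fubini_tonelli_F k).
  - by move=> x _; apply: powR_integral_le => // y; exact: psi0.
rewrite ge0_integralZl//; last 3 first.
- exact: (measurable_fun_fubini_tonelli_F k).
- by move=> x _; apply: integral_ge0.
- exact: poweR_ge0.
rewrite fubini_tonelli//.
have kn y : (\int[rho]_x k (x, y) <= (n y)%:E)%E.
  under eq_integral do rewrite /k/= mulrC EFinM.
  have mpsiy : measurable_fun setT (fun x => psi (x, y)).
    exact: measurableT_comp.
  rewrite ge0_integralZl//; last 2 first.
  - apply/measurable_EFinP; apply: (measurableT_comp (measurable_powR _)).
    exact: measurableT_comp.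
  - by rewrite lee_fin powR_ge0.
  have := ge0_le_poweR (ltW q0) (Lnorm_ge0 _ _ _) (le_n y).
  rewrite poweR_Lnorm ?gt_eqF//=.
  move=> h.
  (* The exponents [1 - q] and [q] add up only for a nonzero base; at [n y = 0] the bound [h] makes
     the integral of [|psi| ^ q] zero. *)
  have [ny0|ny0] := eqVneq (n y) 0.
    rewrite ny0 powR0 ?gt_eqF// in h.
    rewrite ny0; apply: (@le_trans _ _ ((0 `^ (1 - q))%:E * 0)%E).
      by apply: lee_wpmul2l => //; rewrite lee_fin powR_ge0.
    by rewrite mule0.
  apply: (le_trans (lee_wpmul2l _ h)); first by rewrite lee_fin powR_ge0.
  rewrite -EFinM -powRD; last by rewrite ny0 implybT.
  by rewrite subrK powRr1.
apply: (@le_trans _ _ (C `^ (q - 1) * C)%E).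
  apply: lee_wpmul2l; first exact: poweR_ge0.
  apply: ge0_le_integral => //.
  - by move=> y _; apply: integral_ge0.
  - exact: (measurable_fun_fubini_tonelli_G k).
  - exact/measurable_EFinP.
move: C0 noo; case: C => // c c0 _; rewrite !poweR_EFin -EFinM.
have [->|cn0] := eqVneq c 0; first by rewrite mulr0 lee_fin powR_ge0.
by rewrite -[X in _ * X]powRr1// -powRD ?subrK// cn0 implybT.
Qed.

Lemma measurable_Lnorm_section (psi : Omega * Y -> R) (q : R) :
  measurable_fun setT psi ->
  measurable_fun setT
    (fun y => 'N[rho]_q%:E[(fun x => (psi (x, y))%:E)])%E.
Proof.
move=> mpsi; rewrite unlock/=.
apply: (measurableT_comp (measurable_poweR _)).
apply: (measurable_fun_fubini_tonelli_G (fun xy => (`|psi xy| `^ q)%:E)).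
  apply/measurable_EFinP/(measurableT_comp (measurable_powR _)).
  exact: measurableT_comp.
by move=> xy; rewrite lee_fin powR_ge0.
Qed.

Lemma measurable_integral_norm_section (psi : Omega * Y -> R) :
  measurable_fun setT psi ->
  measurable_fun setT (fun x => \int[mu]_y `|psi (x, y)|%:E)%E.
Proof.
move=> mpsi.
apply: (@measurable_fun_fubini_tonelli_F _ _ _ _ _ mu (fun xy => `|psi xy|%:E)).
  by apply/measurable_EFinP; exact: measurableT_comp.
by move=> xy; rewrite lee_fin.
Qed.

Lemma Lnorm_integral_le (psi : Omega * Y -> R) (q : R) :
  1 <= q -> measurable_fun setT psi ->
  ('N[rho]_q%:E[(fun x => \int[mu]_y `|psi (x, y)|%:E)] <=
    \int[mu]_y 'N[rho]_q%:E[(fun x => (psi (x, y))%:E)])%E.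
Proof.
move=> q1 mpsi; have q0 : 0 < q by rewrite (lt_le_trans ltr01).
set N := fun y => ('N[rho]_q%:E[(fun x => (psi (x, y))%:E)])%E.
have mN : measurable_fun setT N by exact: measurable_Lnorm_section.
have N0 y : (0 <= N y)%E by exact: Lnorm_ge0.
have [->|/eqP Noo] := eqVneq (\int[mu]_y N y)%E +oo%E; first exact: leey.
have {}Noo : (\int[mu]_y N y < +oo)%E by rewrite ltey; exact/eqP.
have iN : mu.-integrable setT N.
  apply/integrableP; split => //.
  by under eq_integral do rewrite gee0_abs//.
(* [Lnorm_integral_le_bound] needs a finite bound whose zeros are zeros of the
   sections, so [psi] is first cut off outside of [A], which changes it only on
   a null set. *)
pose A := [set y | (0 < N y < +oo)%E].
have mA : measurable A.
  rewrite (_ : A = [set y | (0 < N y)%E] `&` [set y | (N y < +oo)%E]).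
    apply: measurableI; rewrite -[X in measurable X]setTI.
    - exact: emeasurable_fun_o_infty.
    - exact: emeasurable_fun_infty_o.
  by apply/seteqP; split => y; [move/andP|move=> h; exact/andP].
pose n y := \1_A y * fine (N y).
pose psi' (xy : Omega * Y) := \1_A xy.2 * psi xy.
have m1 : measurable_fun setT (\1_A : Y -> R) by exact: measurable_indic.
have mpsi' : measurable_fun setT psi'.
  by apply: measurable_funM => //; exact: measurableT_comp.
have mn : measurable_fun setT n.
  by apply: measurable_funM => //; exact: measurableT_comp.
have nN y : ((n y)%:E <= N y)%E.
  rewrite /n indicE; case: (boolP (y \in A)) => [/set_mem/andP[N1 N2]|_].
    by rewrite mul1r fineK// ge0_fin_numE.
  by rewrite mul0r.
have n0 y : 0 <= n y by rewrite /n mulr_ge0// fine_ge0.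
have le_nN : (\int[mu]_y (n y)%:E <= \int[mu]_y N y)%E.
  apply: ge0_le_integral => //; last exact/measurable_EFinP.
  by move=> y _; rewrite lee_fin.
have psi'0 x y : n y = 0 -> psi' (x, y) = 0.
  rewrite /n /psi' indicE; case: (boolP (y \in A)) => [/set_mem/andP[N1 N2]|_ _].
    rewrite mul1r => /eqP; rewrite gt_eqF// fine_gt0//.
    by rewrite N1.
  by rewrite mul0r.
have psi'n y : ('N[rho]_q%:E[(fun x => (psi' (x, y))%:E)] <= (n y)%:E)%E.
  rewrite /n /psi'/= indicE; case: (boolP (y \in A)) => [/set_mem/andP[N1 N2]|_].
    under eq_Lnorm do rewrite mul1r.
    by rewrite mul1r fineK// ge0_fin_numE.
  under eq_Lnorm do rewrite mul0r.
  by rewrite mul0r Lnorm0// eqe gt_eqF.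
have := Lnorm_integral_le_bound q1 mn mpsi' n0 psi'0 (le_lt_trans le_nN Noo)
  psi'n.
move=> /le_trans/(_ le_nN); apply: le_trans.
(* [N y] is finite for almost every [y]. If it is zero, the section of [psi] vanishes a.e.;
   otherwise [y] lies in [A] and the two sections coincide. *)
have ae0 : \forall y \ae mu, (\int[rho]_x `|psi (x, y) - psi' (x, y)|%:E = 0)%E.
  apply: filterS (integrable_ae measurableT iN) => y /(_ I) Ny.
  have [Ny0|Ny0] := eqVneq (N y) 0%E.
    have mpsiy : measurable_fun setT (fun x => (psi (x, y))%:E).
      by apply/measurable_EFinP; exact: measurableT_comp.
    have q0' : (0 < q%:E)%E by [].
    have py0 := Lnorm_eq0_eq0 mpsiy q0' Ny0.
    have nAy : \1_A y = 0 :> R.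
      by rewrite indicE; case: (boolP (y \in A)) => // /set_mem/andP[]; rewrite Ny0 ltxx.
    rewrite /psi'/= nAy; under eq_integral do rewrite mul0r subr0.
    exact/(ae_eq_integral_abs rho measurableT mpsiy).
  have Ay : \1_A y = 1 :> R.
    rewrite indicE mem_set//; apply/andP; split; first by rewrite lt0e Ny0 N0.
    by rewrite ltey_eq Ny.
  rewrite /psi'/= Ay; under eq_integral do rewrite mul1r subrr normr0.
  exact: integral0.
have mD : measurable_fun setT (fun xy => psi xy - psi' xy).
  exact: measurable_funB.
(* Tonelli turns the null sets in [x] for almost every [y] into null sets in [y] for almost every
   [x]. *)
have int0 : (\int[rho]_x \int[mu]_y `|psi (x, y) - psi' (x, y)|%:E = 0)%E.
  rewrite (@fubini_tonelli _ _ _ _ _ rho mu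
    (fun xy => `|psi xy - psi' xy|%:E))//; last first.
    by apply/measurable_EFinP; exact: measurableT_comp.
  rewrite (@ge0_ae_eq_integral _ _ _ mu setT _ (cst 0%E)) ?integral0//.
  - apply: (@measurable_fun_fubini_tonelli_G _ _ _ _ _ rho
      (fun xy => `|psi xy - psi' xy|%:E)).
      by apply/measurable_EFinP; exact: measurableT_comp.
    by move=> xy; rewrite lee_fin.
  - by move=> y _; apply: integral_ge0 => x _; rewrite lee_fin.
  - by apply: filterS ae0 => y h _.
have aex : \forall x \ae rho,
    (\int[mu]_y `|psi (x, y) - psi' (x, y)|%:E = 0)%E.
  have mI : measurable_fun setT
      (fun x => \int[mu]_y `|psi (x, y) - psi' (x, y)|%:E)%E.
    exact: (measurable_integral_norm_section mD).
  have [+ _] := ae_eq_integral_abs rho measurableT mI.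
  move=> /(_ _) h.
  apply: filterS (h _) => [x|]; first exact.
  rewrite -[RHS]int0; apply: eq_integral => x _.
  by rewrite gee0_abs// integral_ge0// => y _; rewrite lee_fin.
rewrite le_eqVlt; apply/orP; left; apply/eqP.
rewrite unlock/=; congr (_ `^ _)%E; apply: ge0_ae_eq_integral => //.
- apply: (measurableT_comp (measurable_poweR _)); apply: measurableT_comp => //.
  exact: measurable_integral_norm_section.
- apply: (measurableT_comp (measurable_poweR _)); apply: measurableT_comp => //.
  exact: measurable_integral_norm_section.
- by move=> x _; exact: poweR_ge0.
- by move=> x _; exact: poweR_ge0.
- apply: filterS aex => x hx _; congr (`| _ | `^ _)%E.
  have mx (h : Omega * Y -> R) : measurable_fun setT h ->
      measurable_fun setT (fun y => `|h (x, y)|%:E).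
    by move=> mh; apply/measurable_EFinP; do 2 apply: measurableT_comp => //.
  (* At each point [psi'] is [psi] or [0], so [|psi| = |psi'| + |psi - psi'|], and the last term
     integrates to zero. *)
  rewrite -[RHS]adde0 -hx -ge0_integralD//; last 2 first.
  - exact: mx.
  - exact: (mx (fun xy => psi xy - psi' xy)).
  apply: eq_integral => y _; rewrite /psi'/= indicE -EFinD; congr (_%:E).
  by case: (y \in A); rewrite ?mul1r ?mul0r ?subrr ?subr0 normr0 ?addr0 ?add0r.
Qed.

End Minkowski.

(** * Integrals of sections: measurability, integrability and norm bound *)

Section SectionIntegral.
Context {R : realType} {dO dY : measure_display}.
Context {Omega : measurableType dO} {Y : measurableType dY}.
Variable rho : {sigma_finite_measure set Omega -> \bar R}.
Variable mu : {sigma_finite_measure set Y -> \bar R}.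

Lemma le_Lnorm (f g : Omega -> \bar R) (q : R) : 0 < q ->
  measurable_fun setT f -> measurable_fun setT g ->
  (forall x, `|f x| <= `|g x|)%E -> ('N[rho]_q%:E[f] <= 'N[rho]_q%:E[g])%E.
Proof.
move=> q0 mf mg fg; rewrite unlock/=.
have mp (h : Omega -> \bar R) : measurable_fun setT h ->
    measurable_fun setT (fun x => `|h x| `^ q)%E.
  by move=> mh; apply: (measurableT_comp (measurable_poweR _)); exact: measurableT_comp.
apply: ge0_le_poweR; first by rewrite invr_ge0 ltW.
  by apply: integral_ge0 => x _; exact: poweR_ge0.
apply: ge0_le_integral => //; [|exact: mp|exact: mp|].
  by move=> x _; exact: poweR_ge0.
by move=> x _; apply: ge0_le_poweR => //; exact: ltW.
Qed.

Lemma measurable_Rintegral_section (psi : Omega * Y -> R) :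
  measurable_fun setT psi ->
  measurable_fun setT (fun x => \int[mu]_y psi (x, y)).
Proof.
move=> mpsi; apply: (@measurableT_comp _ _ _ _ _ _ fine) => //.
have mE : measurable_fun setT (EFin \o psi) by exact/measurable_EFinP.
under eq_fun do rewrite integralE.
apply: emeasurable_funB.
- under eq_fun do rewrite -[X in integral _ _ X^\+%E]/((EFin \o psi) \o pair _) funepos_comp.
  apply: measurable_fun_fubini_tonelli_F; first exact: measurable_funepos.
  by move=> xy; exact: funepos_ge0.
- under eq_fun do rewrite -[X in integral _ _ X^\-%E]/((EFin \o psi) \o pair _) funeneg_comp.
  apply: measurable_fun_fubini_tonelli_F; first exact: measurable_funeneg.
  by move=> xy; exact: funeneg_ge0.
Qed.

(** By Minkowski the [q]-th power of [g x], the integral of [|psi (x, _)|], has finite integral,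
    hence is finite a.e.; and [+oo] to a positive power is [+oo], so [g] is finite a.e. too. *)
Lemma ae_integrable_section (psi : Omega * Y -> R) (q : R) :
  1 <= q -> measurable_fun setT psi ->
  (\int[mu]_y 'N[rho]_q%:E[(fun x => (psi (x, y))%:E)] < +oo)%E ->
  \forall x \ae rho, mu.-integrable setT (fun y => (psi (x, y))%:E).
Proof.
move=> q1 mpsi Noo; have q0 : 0 < q by rewrite (lt_le_trans ltr01).
have := le_lt_trans (Lnorm_integral_le rho mu q1 mpsi) Noo.
move=> /(poweR_lty q); rewrite poweR_Lnorm ?gt_eqF//.
set g := fun x => (\int[mu]_y `|psi (x, y)|%:E)%E => goo.
have mg : measurable_fun setT g by exact: measurable_integral_norm_section.
have ig : rho.-integrable setT (fun x => `|g x| `^ q)%E.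
  apply/integrableP; split.
    apply: (measurableT_comp (measurable_poweR _)); exact: measurableT_comp.
  by under eq_integral do rewrite gee0_abs ?poweR_ge0//.
apply: filterS (integrable_ae measurableT ig) => x /(_ I) gx.
apply/integrableP; split.
  by apply/measurable_EFinP; exact: measurableT_comp.
rewrite -/(g x) ltey; apply/eqP => gxoo; move: gx.
by rewrite [g x]gxoo/= gt_eqF.
Qed.

Lemma Lnorm_Rintegral_le (psi : Omega * Y -> R) (q : R) :
  1 <= q -> measurable_fun setT psi ->
  ('N[rho]_q%:E[EFin \o (fun x => \int[mu]_y psi (x, y))%R] <=
   \int[mu]_y 'N[rho]_q%:E[(fun x => (psi (x, y))%:E)])%E.
Proof.
move=> q1 mpsi; have q0 : 0 < q by rewrite (lt_le_trans ltr01).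
apply: le_trans (Lnorm_integral_le rho mu q1 mpsi).
apply: le_Lnorm => //.
- by apply/measurable_EFinP; exact: measurable_Rintegral_section.
- exact: measurable_integral_norm_section.
move=> x /=; rewrite [leRHS]gee0_abs; last by apply: integral_ge0.
have mx : measurable_fun setT (fun y => (psi (x, y))%:E).
  by apply/measurable_EFinP; exact: measurableT_comp.
apply: le_trans (le_abse_integral mu measurableT mx).
(* [Rintegral] has the default value [0] where the integral is infinite, which respects the
   bound. *)
by rewrite /Rintegral; case: (integral _ _ _) => //=; rewrite normr0 leey.
Qed.

End SectionIntegral.

Section LspaceAe.
Context {R : realType} d (T : measurableType d).
Variables (mu : {measure set T -> \bar R}) (p : \bar R) (p1 : (1 <= p)%E).
Let X := LspaceType mu p1.

Lemma measurable_Lspace (F : X) : measurable_fun setT (F : T -> R).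
Proof. by have /andP[/set_mem] := Lspace_Lfun F. Qed.

Lemma Lspace_normE_ae (F : X) (f : T -> R) : measurable_fun setT f ->
  (\forall x \ae mu, (F : T -> R) x = f x) ->
  (`|F|%:E = 'N[mu]_p[EFin \o f])%E.
Proof.
move=> mf Ff; rewrite Lspace_normE; apply: ae_eq_Lnorm => //.
  exact: measurable_Lspace.
by apply: filterS Ff => x + _.
Qed.

End LspaceAe.

(** * Sections of a measurable function as elements of L^q *)

Section LqSection.
Context {R : realType} {dO dY : measure_display}.
Context {Omega : measurableType dO} {Y : measurableType dY}.
Variable rho : {sigma_finite_measure set Omega -> \bar R}.
Variable mu : {sigma_finite_measure set Y -> \bar R}.
Variables (q : R) (q1 : (1 <= q%:E)%E).
Let X : normedModType R := LspaceType rho q1.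

Section norm.
Variables (psi : Omega * Y -> R) (mpsi : measurable_fun setT psi).
Variables (Psi : Y -> X).
Hypothesis PsiE :
  forall y, \forall x \ae rho, (Psi y : Omega -> R) x = psi (x, y).

Lemma norm_section y :
  (`|Psi y|%:E = 'N[rho]_q%:E[(fun x => (psi (x, y))%:E)])%E.
Proof. by apply: Lspace_normE_ae (PsiE y); exact: measurableT_comp. Qed.

Lemma measurable_norm_section : measurable_fun setT (fun y => `|Psi y|).
Proof.
apply/measurable_EFinP => /=; rewrite [X in measurable_fun _ X](_ : _ =
  (fun y => 'N[rho]_q%:E[(fun x => (psi (x, y))%:E)])%E).
  exact: measurable_Lnorm_section.
by apply/funext => y /=; rewrite norm_section.
Qed.

Lemma norm_Lclass_Rintegral_le
    (hf : (fun x => \int[mu]_y psi (x, y)) \in Lfun rho q%:E) :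
  (`|(Lclass q1 hf : X)|%:E <= \int[mu]_y `|Psi y|%:E)%E.
Proof.
rewrite (Lspace_normE_ae (measurable_Rintegral_section mu mpsi)); last first.
  by apply: filterS (LclassE q1 hf) => x /(_ I).
under eq_integral do rewrite norm_section.
exact: Lnorm_Rintegral_le.
Qed.

Hypothesis Psioo : (\int[mu]_y `|Psi y|%:E < +oo)%E.

Lemma Rintegral_section_Lfun :
  (fun x => \int[mu]_y psi (x, y)) \in Lfun rho q%:E.
Proof.
rewrite inE; apply/andP; split; rewrite inE/=.
  exact: measurable_Rintegral_section.
apply: le_lt_trans (Lnorm_Rintegral_le rho mu _ mpsi) _ => //.
by under eq_integral do rewrite -norm_section.
Qed.

Lemma ae_integrable_Lq_section :
  \forall x \ae rho, mu.-integrable setT (fun y => (psi (x, y))%:E).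
Proof.
apply: (ae_integrable_section q1) => //.
by under eq_integral do rewrite -norm_section.
Qed.

End norm.

(* Minkowski's inequality for [psi (x, y) - \sum_(v <- r) u v y * v x]. *)
Lemma norm_Lclass_Rintegral_sub_le (psi : Omega * Y -> R)
    (mpsi : measurable_fun setT psi) (Psi : Y -> X)
    (PsiE : forall y, \forall x \ae rho, (Psi y : Omega -> R) x = psi (x, y))
    (Psioo : (\int[mu]_y `|Psi y|%:E < +oo)%E)
    (hf : (fun x => \int[mu]_y psi (x, y)) \in Lfun rho q%:E)
    (r : seq X) (u : X -> Y -> R) :
  (forall v, mu.-integrable setT (EFin \o u v)) ->
  (`|(Lclass q1 hf : X) - \sum_(v <- r) (\int[mu]_y u v y) *: v|%:E <=
   \int[mu]_y `|Psi y - \sum_(v <- r) u v y *: v|%:E)%E.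
Proof.
move=> iu.
have linE (a : X -> R) : \forall x \ae rho,
    (\sum_(v <- r) a v *: v : LspaceType rho q1) x =
    \sum_(v <- r) a v * (v : LspaceType rho q1) x.
  elim: r => [|v r' IH].
    by rewrite big_nil; apply: filterS (Lspace0E rho q1) => x /(_ I) ->; rewrite big_nil.
  rewrite big_cons.
  apply: filterS3 IH (LspaceZE (a v) v)
    (LspaceDE (a v *: v : LspaceType rho q1) (\sum_(j <- r') a j *: j)).
  by move=> x h1 /(_ I) h2 /(_ I) ->; rewrite big_cons /= h2 h1.
have mu_ v : measurable_fun setT (u v).
  by apply/measurable_EFinP; exact: measurable_int (iu v).
pose psi' xy := psi xy - \sum_(v <- r) u v xy.2 * (v : LspaceType rho q1) xy.1.
have mpsi' : measurable_fun setT psi'.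
  apply: measurable_funB => //; apply: measurable_sum => v.
  apply: measurable_funM; first exact: measurableT_comp.
  apply: measurableT_comp => //; exact: measurable_Lspace.
pose Psi' y : X := Psi y - \sum_(v <- r) u v y *: v.
have subE (F G : LspaceType rho q1) :
    \forall x \ae rho, (F - G : LspaceType rho q1) x = F x - G x.
  apply: filterS2 (LspaceDE F (- G)) (LspaceNE G).
  by move=> x /(_ I) -> /(_ I) /= ->.
have Psi'E y : \forall x \ae rho, (Psi' y : LspaceType rho q1) x = psi' (x, y).
  apply: filterS3 (linE (u^~ y)) (PsiE y)
    (subE (Psi y) (\sum_(v <- r) u v y *: v)).
  by move=> x h1 h2 ->; rewrite h1 h2.
have [->|/eqP Poo] := eqVneq (\int[mu]_y `|Psi' y|%:E)%E +oo%E; first exact: leey.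
have {}Poo : (\int[mu]_y `|Psi' y|%:E < +oo)%E by rewrite ltey; exact/eqP.
have hf' := Rintegral_section_Lfun mpsi' Psi'E Poo.
apply: le_trans (norm_Lclass_Rintegral_le mpsi' Psi'E hf').
(* Both sides are norms of the same class: the section of [psi] is integrable for almost every [x],
   and there the integral of [psi'] splits by linearity. *)
rewrite le_eqVlt; apply/orP; left; apply/eqP; congr (`| _ |%:E).
apply/Lspace_eqP.
apply: filterS3 (filterI (subE (Lclass q1 hf) (\sum_(v <- r) (\int[mu]_y u v y) *: v))
  (linE (fun v => \int[mu]_y u v y)))
  (filterI (LclassE q1 hf) (LclassE q1 hf'))
  (ae_integrable_Lq_section mpsi PsiE Psioo) => x [-> ->] [h1 h2] ix _.
rewrite (h1 I) (h2 I) /psi'.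
have iuv v : mu.-integrable setT (fun y => (u v y * (v : LspaceType rho q1) x)%:E).
  under eq_fun do rewrite EFinM muleC; exact: (integrableZl measurableT _ (iu v)).
rewrite RintegralB//; last first.
  rewrite (_ : _ \o _ = fun y => \sum_(v <- r) (u v y * (v : LspaceType rho q1) x)%:E)%E.
    exact: integrable_sum.
  by apply/funext => y /=; rewrite sumEFin.
congr (_ - _).
elim: r {psi' mpsi' Psi' linE Psi'E Poo hf' h2} => [|v r' IH].
  by rewrite big_nil; under eq_Rintegral do rewrite big_nil; rewrite Rintegral_cst// mul0r.
rewrite /= big_cons IH/=; under [RHS]eq_Rintegral do rewrite big_cons.
rewrite RintegralD//; first by rewrite (RintegralZr _ _ (iu v)).
  exact: iuv.
rewrite (_ : _ \o _ = fun y => \sum_(v <- r') (u v y * (v : LspaceType rho q1) x)%:E)%E.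
  exact: integrable_sum.
by apply/funext => y /=; rewrite sumEFin.
Qed.

End LqSection.

(** * Approximation in separable normed spaces *)

(** Separability passes to subsets of a metric space: for each pair [(n, m)] choose a point of [G]
    within [m.+1%:R^-1] of the dense point [d n], if there is one. A point [v] of [G] near [d n]
    witnesses that the choice succeeds, and the chosen point is then close to [v]. *)
Lemma separable_subset_seq {R : realType} (X : normedModType R) (G : set X) :
  separable X -> G !=set0 ->
  exists2 e : nat -> X, forall i, G (e i) &
    forall v, G v -> forall eps : R, 0 < eps -> exists i, `|e i - v| < eps.
Proof.
move=> [D cD dD] [g0 Gg0].
have [d dE] : exists d : nat -> X, set_surj setT D d by exact/pcard_surjP.
pose near_d (nm : nat * nat) := [set g | G g /\ `|g - d nm.1| < nm.2.+1%:R^-1].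
(* Pairs are coded by natural numbers; when no point qualifies the default [g0] keeps the sequence
   inside [G]. *)
pose e i := xget g0 (near_d (odflt (0, 0)%N (unpickle i))).
exists e => [i|v Gv eps eps0].
  by rewrite /e; case: xgetP => // g _ [].
have [m] := ltr_add_invr (divr_gt0 eps0 (ltr0n R 2)).
rewrite add0r => meps.
have m0 : 0 < m.+1%:R^-1 :> R by rewrite invr_gt0.
have [u [vu]] := dD (ball v (m.+1%:R^-1))
  (ex_intro _ v (ballxx v m0)) (ball_open _ _).
move=> /dE[n _ dnu].
have vE : near_d (n, m) v.
  by split => //=; rewrite dnu -ball_normE in vu *.
exists (pickle (n, m)); rewrite /e pickleK/=.
have [_ /= en] := xgetPex g0 (ex_intro _ v vE).
have [_ /= vn] := vE.
rewrite -(subrKA (d n)) (le_lt_trans (ler_normD _ _))//.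
rewrite (splitr eps) ltrD// ?(lt_trans en)//.
by rewrite distrC (lt_trans vn).
Qed.

Section nearest.
Context {R : realType} (X : normedModType R) (e : nat -> X).

(* The closest point to [v] among [0, e 0, ..., e k.-1]; including [0] is what
   makes [nearest_dist_le] hold, hence domination by [`|v|]. *)
Fixpoint nearest (k : nat) (v : X) : X :=
  if k is k'.+1 then
    if `|e k' - v| < `|nearest k' v - v| then e k' else nearest k' v
  else 0.

Lemma nearestS_dist k v :
  `|nearest k.+1 v - v| = Num.min `|e k - v| `|nearest k v - v|.
Proof. by rewrite /= minEle; case: ltgtP => //= ->. Qed.

Lemma nearest_dist_le k v : `|nearest k v - v| <= `|v|.
Proof.
elim: k => [|k IH]; first by rewrite /= sub0r normrN.
by rewrite nearestS_dist ge_min IH orbT.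
Qed.

Lemma nearest_dist_le_term i k v : (i < k)%N ->
  `|nearest k v - v| <= `|e i - v|.
Proof.
elim: k => // k IH; rewrite ltnS leq_eqVlt nearestS_dist ge_min.
by move=> /predU1P[->|/IH ->]; rewrite ?lexx ?orbT.
Qed.

Lemma nearest_cvg v : (forall eps : R, 0 < eps -> exists i, `|e i - v| < eps) ->
  nearest k v @[k --> \oo] --> v.
Proof.
move=> ev; apply/cvgrPdist_lt => eps /ev[i hi].
exists i.+1 => // k /= ik; rewrite distrC.
exact: le_lt_trans (nearest_dist_le_term v ik) hi.
Qed.

Lemma nearest_range k v : nearest k v = 0 \/ exists i, nearest k v = e i.
Proof.
elim: k => [|k IH] /=; first by left.
by case: ifP => // _; right; exists k.
Qed.

Lemma finite_range_nearest k (T : Type) (h : T -> X) :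
  finite_set (range (nearest k \o h)).
Proof.
apply: (@sub_finite_set _ _ (0 |` [set e i | i in `I_k])).
  move=> _ [y _ <-] /=; elim: k => [|k IH] /=; first by left.
  case: ifP => _; first by right; exists k => /=.
  by case: IH => [|[i ik <-]]; [left|right; exists i => //=; exact: ltnW].
by rewrite finite_setU; split => //; exact: finite_image.
Qed.

Context d (Y : measurableType d) (h : Y -> X).
Hypothesis mh : forall v, measurable_fun setT (fun y => `|v - h y|).

Lemma measurable_nearest_dist k :
  measurable_fun setT (fun y => `|nearest k (h y) - h y|).
Proof.
elim: k => [|k IH]; first exact: mh.
by under eq_fun do rewrite nearestS_dist; exact: measurable_minr.
Qed.

(** [B] can be arbitrary: [nearest k] has finitely many values, selected by comparing measurable
    distances. *)
Lemma measurable_nearest k (B : set X) :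
  measurable [set y | B (nearest k (h y))].
Proof.
elim: k => [|k IH] /=.
  have [B0|B0] := pselect (B 0).
    by rewrite (_ : [set _ | _] = setT)//; apply/seteqP; split.
  by rewrite (_ : [set _ | _] = set0)//; apply/seteqP; split.
pose D := [set y | `|e k - h y| < `|nearest k (h y) - h y|].
have mD : measurable D.
  rewrite -[D]setTI; apply: measurable_fun_ltr => //.
  exact: measurable_nearest_dist.
rewrite (_ : [set _ | _] =
  (D `&` [set _ | B (e k)]) `|` (~` D `&` [set y | B (nearest k (h y))])).
  apply: measurableU; apply: measurableI => //; last exact: measurableC.
  have [B0|B0] := pselect (B (e k)).
    by rewrite (_ : [set _ | _] = setT)//; apply/seteqP; split.
  by rewrite (_ : [set _ | _] = set0)//; apply/seteqP; split.
apply/seteqP; split => y; rewrite /D/=.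
  by case: ifPn => [? ?|/negP ? ?]; [left|right].
by case=> [[-> //]|[/negP/negbTE -> //]].
Qed.

(** [U] is a countable union of balls with centres [e n] and radii [m.+1%:R^-1], and the preimage of
    a ball is measurable because the distance to its centre is. *)
Lemma measurable_preimage_dense (U : set X) :
  (forall v (eps : R), 0 < eps -> exists i, `|e i - v| < eps) ->
  open U -> measurable (h @^-1` U).
Proof.
move=> ed oU.
pose P n m := [set y | `|e n - h y| < m.+1%:R^-1] `&`
  [set _ | ball (e n) m.+1%:R^-1 `<=` U].
have mP n m : measurable (P n m).
  apply: measurableI.
    rewrite -[X in measurable X]setTI; exact: measurable_fun_ltr.
  have [B0|B0] := pselect (ball (e n) (m.+1%:R^-1 : R) `<=` U).
    by rewrite (_ : [set _ | _] = setT)//; apply/seteqP; split.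
  by rewrite (_ : [set _ | _] = set0)//; apply/seteqP; split.
rewrite (_ : h @^-1` U = \bigcup_n \bigcup_m P n m).
  by apply: bigcupT_measurable => n; exact: bigcupT_measurable.
apply/seteqP; split => y /=; last first.
  move=> [n _ [m _ [/= h1]]]; apply.
  by rewrite -ball_normE.
move=> Uhy; have /nbhs_ballP[eps /= eps0 epsU] := open_nbhs_nbhs (conj oU Uhy).
(* A radius below [eps / 2] keeps any such ball that contains [h y] within [eps] of [h y], hence
   inside [U]. *)
have [m] := ltr_add_invr (divr_gt0 eps0 (ltr0n R 2)).
rewrite add0r => meps.
have m0 : 0 < m.+1%:R^-1 :> R by rewrite invr_gt0.
have [n hn] := ed (h y) _ m0.
exists n => //; exists m => //; split => //= u.
rewrite -ball_normE /= => eu; apply: epsU; rewrite -ball_normE/=.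
rewrite -(subrKA (e n)) (le_lt_trans (ler_normD _ _))//.
by rewrite (splitr eps) ltrD// ?(lt_trans eu)// distrC (lt_trans hn).
Qed.

End nearest.

Section simple_approximation.
Context {R : realType} (X : normedModType R) d (Y : measurableType d).
Variables (mu : {sigma_finite_measure set Y -> \bar R}) (h : Y -> X).
Hypothesis sX : separable X.
Hypothesis mh : forall v, measurable_fun setT (fun y => `|v - h y|).

Lemma simple_approximation : exists s : nat -> Y -> X,
  [/\ forall k, simple_function mu (s k),
      forall k, measurable_fun setT (fun y => `|s k y - h y|),
      forall k y, `|s k y - h y| <= `|h y| &
      forall y, s k y @[k --> \oo] --> h y].
Proof.
have [e _ ed] := separable_subset_seq sX (ex_intro setT 0 I).
have {}ed v := ed v I.
have [F [TF ndF mF]] :=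
  (sigma_finiteP _ mu).1 (sigma_finiteT mu).
(* Cutting off outside the finite-measure set [F k] gives the nonzero level sets finite measure, and
   the value [0] there keeps the error at most [|h y|]. *)
pose s k y := if y \in F k then nearest e k (h y) else 0.
exists s; split.
- move=> k; split.
    apply: (@sub_finite_set _ _ (0 |` range (nearest e k \o h))).
      move=> _ [[y _ <-] _]; rewrite /s; case: ifP => _; last by left.
      by right; exists y.
    by rewrite finite_setU; split => //; exact: finite_range_nearest.
  move=> v v0.
  have -> : s k @^-1` [set v] = F k `&` [set y | [set v] (nearest e k (h y))].
    apply/seteqP; split => y /=; rewrite /s.
      case: ifPn => [/set_mem //|_ v0']; by rewrite -v0' eqxx in v0.
    by move=> [Fy]; rewrite mem_set.
  have [mFk Fkoo] := mF k.
  have mI : measurable (F k `&` [set y | [set v] (nearest e k (h y))]).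
    by apply: measurableI => //; exact: measurable_nearest.
  split => //; apply: le_lt_trans Fkoo.
  by apply: le_measure; rewrite ?inE//; exact: subIsetl.
- move=> k.
  rewrite (_ : (fun _ => _) = fun y =>
    if y \in F k then `|nearest e k (h y) - h y| else `|0 - h y|); last first.
    by apply/funext => y; rewrite /s; case: ifP.
  apply: measurable_fun_ifT => //; last exact: measurable_nearest_dist.
  apply: (measurable_fun_bool true).
  rewrite setTI (_ : _ @^-1` _ = F k); first by have [] := mF k.
  by apply/seteqP; split => y /=; [move/set_mem|move=> Fy; rewrite mem_set].
- move=> k y; rewrite /s; case: ifP => _; first exact: nearest_dist_le.
  by rewrite sub0r normrN.
- move=> y; have [N _ FNy] : (\bigcup_i F i) y by rewrite -TF.
  apply: cvg_trans (nearest_cvg (ed (h y))); apply: near_eq_cvg.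
  exists N => // k /= Nk; rewrite /s mem_set//.
  by have /subsetPset := ndF _ _ Nk; apply.
Qed.

Lemma separable_strongly_measurable : strongly_measurable mu h.
Proof.
by have [s [? _ _ ?]] := simple_approximation; exists s => //; exact: aeW.
Qed.

(** The errors of [simple_approximation] tend to zero pointwise and are dominated by the integrable
    [|h|]. *)
Lemma separable_Bochner_integrable :
  (\int[mu]_y `|h y|%:E < +oo)%E -> Bochner_integrable mu h.
Proof.
move=> hoo; split; first exact: separable_strongly_measurable.
have [s [s1 s2 s3 s4]] := simple_approximation; exists s; split => //.
have ih : mu.-integrable setT (fun y => `|h y|%:E).
  apply/integrableP; split.
    apply/measurable_EFinP; have := mh 0.
    by under eq_fun do rewrite sub0r normrN.
  by under eq_integral do rewrite /= normr_id.
have [] := @dominated_convergence _ _ _ mu setT measurableT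
  (fun k y => `|s k y - h y|%:E) (cst 0%E) _ _ _ _ ih _ => //.
- by move=> k; exact/measurable_EFinP.
- apply: aeW => y _; apply: cvg_EFin; first exact: nearW.
  rewrite -[X in _ --> X](@normr0 _ X); apply: cvg_norm; exact/subr_cvg0.
- apply: aeW => y k _ /=; rewrite normr_id lee_fin; exact: s3.
- by move=> _ _; rewrite integral0.
Qed.

End simple_approximation.

Section level_sets.
Context {R : realType} (X : normedModType R) (T : Type).

Lemma sum_level_sets (t : T -> X) (y : T) : finite_set (range t `\ 0) ->
  \sum_(v \in range t `\ 0) ((t y == v)%:R : R) *: v = t y.
Proof.
move=> ft; have [ty0|ty0] := eqVneq (t y) 0.
  rewrite ty0; apply: fsbig1 => v [_ /= /eqP v0].
  by rewrite eq_sym (negbTE v0) scale0r.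
rewrite (fsbigD1 (t y)) //=; last by split; [exists y|exact/eqP].
rewrite eqxx scale1r fsbig1 ?addr0// => v [_ /= /eqP vt].
by rewrite eq_sym (negbTE vt) scale0r.
Qed.

Lemma level_indicE (t : T -> X) (v : X) (y : T) :
  (t y == v)%:R = \1_(t @^-1` [set v]) y :> R.
Proof.
rewrite indicE; congr (nat_of_bool _)%:R.
by apply/idP/idP => [/eqP ty|]; rewrite inE//= => ->.
Qed.

End level_sets.

(** * Variation with respect to a set *)

Section variation_theory.
Context {R : realType} (X : normedModType R) (G : set X).
Implicit Types (f g : X).

Let hull := convex_hull (pm_set G).

Lemma pm_set_hull g : pm_set G g -> hull g.
Proof. by move=> Gg M [_]; exact. Qed.

Lemma convex_hull_comb (t : R) f g : 0 <= t <= 1 -> hull f -> hull g ->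
  hull (t *: f + (1 - t) *: g).
Proof.
move=> t01 hf hg M [cM GM].
(* [convex_set] quantifies over coefficients bundled with a proof of membership in the unit
   interval. *)
have itv : Itv.spec (@Itv.num_sem R) (Itv.Real `[0%Z, 1%Z]) t.
  by rewrite /= /Itv.num_sem/= realE in_itv/= t01; case/andP: t01 => ->.
have := @cM f g (Itv.mk itv) (mem_set (hf M (conj cM GM))) (mem_set (hg M (conj cM GM))).
by move=> /set_mem.
Qed.

(** The sign of each coefficient is moved into its vector, which stays in [pm_set G]. By induction
    the tail is [l - |c v|] times a hull point, and dividing by [l] leaves a convex combination with
    weight [|c v| / l]. *)
Lemma signed_sum_hull (l : R) (r : seq X) (c : X -> R) : G !=set0 ->
  (forall v, v \in r -> G v) -> \sum_(v <- r) `|c v| <= l ->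
  exists2 z, hull z & \sum_(v <- r) c v *: v = l *: z.
Proof.
move=> [g0 Gg0]; elim: r l => [|v r IH] l rG.
  (* The hull contains [0] as the midpoint of [g0] and [- g0]; this absorbs any slack between [l]
     and the sum of the [|c v|]. *)
  rewrite !big_nil => l0; exists 0; last by rewrite scaler0.
  rewrite (_ : 0 = 2^-1 *: g0 + (1 - 2^-1) *: (- g0)).
    apply: convex_hull_comb; first by rewrite invr_ge0 ler0n invf_le1// ler1n.
      by apply: pm_set_hull; left.
    by apply: pm_set_hull; right; exists g0.
  have h2 : 2^-1 + 2^-1 = 1 :> R by rewrite [RHS]splitr div1r.
  by rewrite scalerN -scalerBl opprB addrA h2 subrr scale0r.
rewrite !big_cons => cl.
have cl' : \sum_(j <- r) `|c j| <= l - `|c v| by rewrite lerBrDl.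
have Gv : G v by apply: rG; rewrite mem_head.
have [|z hz ->] := IH _ _ cl'.
  by move=> u ur; apply: rG; rewrite in_cons ur orbT.
have s0 : 0 <= \sum_(j <- r) `|c j| by exact: sumr_ge0.
have cv_le : `|c v| <= l by rewrite (le_trans _ cl)// lerDl.
pose sv := if 0 <= c v then v else - v.
have hsv : hull sv.
  apply: pm_set_hull; rewrite /sv; case: ifP => _; first by left.
  by right; exists v.
have -> : c v *: v = `|c v| *: sv.
  rewrite /sv; case: ifPn => [c0|]; first by rewrite ger0_norm.
  by rewrite -ltNge => c0; rewrite ltr0_norm// scalerN scaleNr opprK.
have [l0|l0] := eqVneq l 0.
  have c0 : `|c v| = 0 by apply/eqP; rewrite eq_le normr_ge0 andbT -l0.
  by exists z => //; rewrite c0 l0 subr0 !scale0r addr0.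
have lgt0 : 0 < l by rewrite lt_neqAle eq_sym l0 (le_trans _ cv_le).
exists ((`|c v| / l) *: sv + (1 - `|c v| / l) *: z).
  apply: convex_hull_comb => //.
  apply/andP; split; first by apply: divr_ge0 => //; exact: ltW.
  by rewrite ler_pdivrMr// mul1r.
rewrite scalerDr !scalerA mulrBr mulr1 mulrCA divff// mulr1//.
Qed.

Lemma signed_fsum_hull (l : R) (A : set X) (c : X -> R) : G !=set0 ->
  finite_set A -> A `<=` G -> \sum_(v \in A) `|c v| <= l ->
  exists2 z, hull z & \sum_(v \in A) c v *: v = l *: z.
Proof.
move=> G0 fA AG; rewrite !fsbig_finite//; apply: signed_sum_hull => // v vA.
by apply/AG/set_mem; rewrite -in_fset_set.
Qed.

Lemma variation_ballP f : variation_ball G f <->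
  forall eps : R, 0 < eps -> exists2 z, hull z & `|f - z| < eps.
Proof.
split=> [cf eps eps0|fE B /nbhs_ballP[eps /= eps0 sB]].
  have [z [hz]] := cf _ (nbhsx_ballx f _ eps0).
  by rewrite -ball_normE; exists z.
have [z hz fz] := fE _ eps0; exists z; split => //.
by apply: sB; rewrite -ball_normE.
Qed.

(** The closed ball of radius [s] is convex and contains [pm_set G], hence the hull; limits of hull
    points satisfy the same bound. *)
Lemma variation_ball_norm_le (s : R) f : (forall g, G g -> `|g| <= s) ->
  variation_ball G f -> `|f| <= s.
Proof.
move=> Gs /variation_ballP fE; apply/ler_addgt0Pr => eps eps0.
have [z hz fz] := fE _ eps0.
have hs : hull `<=` [set z | `|z| <= s].
  apply: smallest_sub.
    move=> x y t; rewrite !inE/= => xs ys.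
    apply: le_trans (ler_normD _ _) _.
    rewrite !normrZ.
    have t0 : 0 <= t%:num by [].
    have t1 : 0 <= 1 - t%:num by rewrite subr_ge0.
    rewrite (ger0_norm t0) (ger0_norm t1).
    rewrite -[leRHS](_ : t%:num * s + (1 - t%:num) * s = s).
      by apply: lerD; rewrite ler_wpM2l.
    by rewrite -mulrDl addrC subrK mul1r.
  by move=> _ [/Gs //|[g /Gs gs <-]]; rewrite /= normrN.
rewrite -(subrK z f) addrC (le_trans (ler_normD _ _))//.
by apply: lerD; [exact: hs|exact: ltW].
Qed.

(** Every scale [W + eps] is admissible, which bounds the variation norm even when [W] is zero. Each
    admissible [l] satisfies [|f| <= l * s] with [s] the supremum of norms on [G], and the infimum
    over [l] gives the third claim. *)
Lemma variation_bounds (W L : R) f : G !=set0 -> 0 <= W ->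
  (forall g, G g -> `|g| <= L) ->
  (forall l : R, 0 < l -> W <= l -> variation_ball G (l^-1 *: f)) ->
  [/\ variation_space G f,
      (variation_norm G f <= W%:E)%E,
      (`|f|%:E <= variation_norm G f * variation_sup G)%E &
      (variation_norm G f * variation_sup G <= W%:E * L%:E)%E].
Proof.
move=> [g0 Gg0] W0 GL fW.
have nW : (variation_norm G f <= W%:E)%E.
  apply/lee_addgt0Pr => eps eps0; apply: ereal_inf_lbound.
  have l0 : 0 < W + eps by rewrite ltr_wpDl.
  exists (W + eps); last by rewrite EFinD.
  by split => //; apply: fW => //; rewrite lerDl ltW.
have n0 : (0 <= variation_norm G f)%E.
  by apply: le_ereal_inf_tmp => _ [l [l0 _] <-]; rewrite lee_fin ltW.
have sL : (variation_sup G <= L%:E)%E.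
  by apply: ge_ereal_sup => _ [g Gg <-]; rewrite lee_fin GL.
have s0 : (0 <= variation_sup G)%E.
  apply: (@le_trans _ _ `|g0|%:E); first by rewrite lee_fin.
  by apply: ereal_sup_ubound; exists g0.
split => //; last exact: lee_pmul.
  have l0 : 0 < W + 1 by rewrite ltr_wpDl.
  by exists (W + 1) => //; apply: fW => //; rewrite lerDl.
have [s sE] : exists s : R, variation_sup G = s%:E.
  by exists (fine (variation_sup G)); rewrite fineK// ge0_fin_numE// (le_lt_trans sL)// ltry.
have [n nE] : exists n : R, variation_norm G f = n%:E.
  by exists (fine (variation_norm G f)); rewrite fineK// ge0_fin_numE// (le_lt_trans nW)// ltry.
have Gs g : G g -> `|g| <= s.
  by move=> Gg; rewrite -lee_fin -sE; apply: ereal_sup_ubound; exists g.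
have fls l : 0 < l -> variation_ball G (l^-1 *: f) -> `|f| <= l * s.
  move=> l0 /(variation_ball_norm_le Gs).
  by rewrite normrZ gtr0_norm ?invr_gt0// mulrC ler_pdivrMr// mulrC.
rewrite sE in s0 *; rewrite lee_fin in s0.
(* Passing to the infimum divides by [s]; for [s = 0] the single scale [W + 1] already forces [f] to
   have norm zero. *)
have [s00|sn0] := eqVneq s 0.
  have l0 : 0 < W + 1 by rewrite ltr_wpDl.
  rewrite s00 mule0 lee_fin -(mulr0 (W + 1)) -s00; apply: fls => //.
  by apply: fW => //; rewrite lerDl.
have sgt0 : 0 < s by rewrite lt_neqAle eq_sym sn0.
rewrite nE -EFinM lee_fin -ler_pdivrMr// -lee_fin -nE.
apply: le_ereal_inf_tmp => _ [l [l0 bl] <-].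
by rewrite lee_fin ler_pdivrMr// fls.
Qed.

End variation_theory.

(** * Integrals of L^q-valued functions *)

Section Bochner_Lq.
Context {R : realType} {dO dY : measure_display}.
Context {Omega : measurableType dO} {Y : measurableType dY}.
Variable rho : {sigma_finite_measure set Omega -> \bar R}.
Variable mu : {sigma_finite_measure set Y -> \bar R}.
Variables (q : R) (q1 : (1 <= q%:E)%E).
Let X : normedModType R := LspaceType rho q1.
Variables (psi : Omega * Y -> R) (mpsi : measurable_fun setT psi).
Variables (Psi : Y -> X).
Hypothesis PsiE :
  forall y, \forall x \ae rho, (Psi y : Omega -> R) x = psi (x, y).

(** The distance is the L^q norm of a section of the jointly measurable function [v x - psi (x, y)].
    It is the form of measurability of [Psi] that the nearest-point construction takes as input. *)
Lemma measurable_dist_section (v : X) :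
  measurable_fun setT (fun y => `|v - Psi y|).
Proof.
apply: (@measurable_norm_section _ _ _ _ _ _ _ q1
  (fun xy => (v : LspaceType rho q1) xy.1 - psi xy)).
  apply: measurable_funB => //; apply: measurableT_comp => //.
  exact: measurable_Lspace.
move=> y; apply: filterS3 (PsiE y) (LspaceNE (Psi y)) (LspaceDE v (- Psi y)).
by move=> x h1 /(_ I) h2 /(_ I) ->; rewrite /= h2 /= h1.
Qed.

Hypothesis Psioo : (\int[mu]_y `|Psi y|%:E < +oo)%E.
Variable hf : (fun x => \int[mu]_y psi (x, y)) \in Lfun rho q%:E.

Lemma norm_Lclass_Rintegral_sub_level (omega : Y -> R) (t : Y -> X) :
  finite_set (range t `\ 0) ->
  (forall v, v != 0 ->
    mu.-integrable setT (fun y => (omega y * (t y == v)%:R)%:E)) ->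
  (`|(Lclass q1 hf : X) - \sum_(v \in range t `\ 0)
      (\int[mu]_y (omega y * (t y == v)%:R)) *: v|%:E <=
   \int[mu]_y `|Psi y - omega y *: t y|%:E)%E.
Proof.
(* The test [v != 0] makes [u v] integrable for every [v]: the zero level set of a simple function
   may have infinite measure. *)
move=> ft it; pose u v y := omega y * ((v != 0) && (t y == v))%:R.
have iu v : mu.-integrable setT (EFin \o u v).
  rewrite /u /comp; have [v0|v0] := eqVneq v 0; last exact: it.
  by under eq_fun do rewrite mulr0; exact: integrable0.
have uE y : \sum_(v \in range t `\ 0) u v y *: v = omega y *: t y.
  rewrite -[in RHS](sum_level_sets y ft) [in RHS]fsbig_finite// scaler_sumr.
  rewrite -fsbig_finite//; apply: eq_fsbigr => v /set_mem[_ /= /eqP v0].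
  by rewrite /u v0 scalerA.
under eq_integral do rewrite -uE fsbig_finite//.
rewrite (eq_fsbigr (fun v => (\int[mu]_y u v y) *: v)); last first.
  move=> v /set_mem[_ /= /eqP v0]; congr (_ *: _); apply: eq_Rintegral => y _.
  by rewrite /u v0.
rewrite fsbig_finite//.
exact: norm_Lclass_Rintegral_sub_le.
Qed.

(** With [omega = 1] the level-set estimate bounds the distance from the class to the integral of
    [s k] by the integral of [|s k - Psi|], which tends to zero for any approximating sequence. *)
Lemma is_Bochner_integral_Lclass : separable X ->
  is_Bochner_integral mu Psi (Lclass q1 hf).
Proof.
move=> sX; split.
  exact: (separable_Bochner_integrable sX measurable_dist_section).
move=> s [ss s0].
have le_s k : (`|(Lclass q1 hf : X) - simple_integral mu (s k)|%:E <=
    \int[mu]_y `|s k y - Psi y|%:E)%E.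
  have [fs ms] := ss k.
  have := @norm_Lclass_Rintegral_sub_level (cst 1) (s k) fs.
  have iv v : v != 0 ->
      mu.-integrable setT (fun y => (cst 1 y * (s k y == v)%:R)%:E).
    move=> /ms[mv fv]; under eq_fun do rewrite mul1r level_indicE.
    apply/integrableP; split; first exact/measurable_EFinP.
    under eq_integral do rewrite gee0_abs ?lee_fin//.
    by rewrite integral_indic// setIT.
  move=> /(_ iv); rewrite /simple_integral.
  rewrite (eq_fsbigr (fun v => fine (mu (s k @^-1` [set v])) *: v)); last first.
    move=> v /set_mem[_ /= /eqP v0]; congr (_ *: _).
    under eq_Rintegral do rewrite mul1r level_indicE.
    by rewrite /Rintegral integral_indic ?setIT//; have [] := ms _ v0.
  move=> /le_trans; apply.
  by under eq_integral do rewrite scale1r distrC.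
apply/cvgrPdist_lt => eps eps0.
(* The extended-real integrals are finite only eventually. *)
have /fine_cvgP[sfin /cvgrPdist_lt/(_ _ eps0) slt] := s0.
apply: filterS2 sfin slt => k /fineK kfin; rewrite sub0r normrN => kt.
rewrite -lte_fin; apply: le_lt_trans (le_s k) _; rewrite -kfin lte_fin.
exact: le_lt_trans (ler_norm _) kt.
Qed.

End Bochner_Lq.

Lemma sum_level_indic_le1 {R : realType} (X : normedModType R) (T : Type)
    (t : T -> X) (y : T) : finite_set (range t `\ 0) ->
  \sum_(v \in range t `\ 0) ((t y == v)%:R : R) <= 1.
Proof.
move=> ft; have [ty0|ty0] := eqVneq (t y) 0.
  rewrite ty0 fsbig1// => v [_ /= /eqP v0].
  by rewrite eq_sym (negbTE v0).
rewrite (fsbigD1 (t y)) //=; last by split; [exists y|exact/eqP].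
rewrite eqxx fsbig1 ?addr0// => v [_ /= /eqP vt].
by rewrite eq_sym (negbTE vt).
Qed.

(** The level sets are disjoint, so the integrals of [|w]] over them add up to at most the whole.
    This is the coefficient bound that [signed_fsum_hull] asks for. *)
Lemma sum_normr_Rintegral_level_le {R : realType} (X : normedModType R)
    d (Y : measurableType d) (mu : {measure set Y -> \bar R})
    (w : Y -> R) (t : Y -> X) :
  mu.-integrable setT (EFin \o w) -> finite_set (range t `\ 0) ->
  (forall v, measurable (t @^-1` [set v])) ->
  (forall v, mu.-integrable setT (fun y => (w y * (t y == v)%:R)%:E)) /\
  \sum_(v \in range t `\ 0) `|\int[mu]_y (w y * (t y == v)%:R)| <=
    \int[mu]_y `|w y|.
Proof.
move=> iw ft mt.
have mw : measurable_fun setT w.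
  by apply/measurable_EFinP; exact: measurable_int iw.
have m1 v : measurable_fun setT (fun y => (t y == v)%:R : R).
  rewrite (_ : (fun _ => _) = \1_(t @^-1` [set v])).
    exact: measurable_indic.
  by apply/funext => y; rewrite level_indicE.
have iwt v : mu.-integrable setT (fun y => (w y * (t y == v)%:R)%:E).
  apply: le_integrable iw => //.
    by apply/measurable_EFinP; exact: measurable_funM.
  move=> y _; rewrite lee_fin normrM.
  by case: (t y == v); rewrite ?normr1 ?normr0 ?mulr1 ?mulr0.
split => //.
have inwt v : mu.-integrable setT (fun y => (`|w y| * (t y == v)%:R)%:E).
  have := integrable_norm (iwt v); apply: eq_integrable => // y _ /=.
  by rewrite normrM; case: (t y == v); rewrite ?normr1 ?normr0.
apply: (@le_trans _ _ (\sum_(v \in range t `\ 0)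
    \int[mu]_y (`|w y| * (t y == v)%:R))).
  rewrite !fsbig_finite//; apply: ler_sum => v _.
  apply: le_trans (le_normr_Rintegral measurableT (iwt v)) _.
  rewrite le_eqVlt; apply/orP; left; apply/eqP; apply: eq_Rintegral => y _.
  by rewrite normrM; case: (t y == v); rewrite ?normr1 ?normr0.
rewrite -lee_fin -fsumEFin//.
under eq_fsbigr.
  move=> v _; rewrite /Rintegral fineK; last exact: integrable_fin_num.
  over.
rewrite -ge0_integral_fsum//; last first.
  move=> v; apply/measurable_EFinP/measurable_funM => //.
  exact: measurableT_comp.
rewrite /Rintegral fineK; last first.
  by apply: integrable_fin_num => //; exact: integrable_norm.
apply: ge0_le_integral => //.
- by move=> y _; apply: fsume_ge0 => v _; rewrite lee_fin mulr_ge0.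
- apply: emeasurable_fsum => // v.
  by apply/measurable_EFinP; apply: measurable_funM => //; exact: measurableT_comp.
- by apply/measurable_EFinP; exact: measurableT_comp.
move=> y _; rewrite fsumEFin// lee_fin fsbig_finite// -mulr_sumr -fsbig_finite//.
by rewrite ler_piMr// sum_level_indic_le1.
Qed.

(** * The integrand [w y *: Phi y]: norm bound and membership in scaled hulls *)

Section weighted.
Context {R : realType} {dO dY : measure_display}.
Context {Omega : measurableType dO} {Y : measurableType dY}.
Variable rho : {sigma_finite_measure set Omega -> \bar R}.
Variable mu : {sigma_finite_measure set Y -> \bar R}.
Variables (q : R) (q1 : (1 <= q%:E)%E).
Let X : normedModType R := LspaceType rho q1.
Hypothesis sX : separable X.
Variables (w : Y -> R) (iw : mu.-integrable setT (EFin \o w)).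
Variables (phi : Omega * Y -> R) (mphi : measurable_fun setT phi).
Variables (Phi : Y -> X).
Hypothesis PhiE :
  forall y, \forall x \ae rho, (Phi y : Omega -> R) x = phi (x, y).
Variables (M : R) (PhiM : \forall y \ae mu, `|Phi y| <= M).

Let mw : measurable_fun setT w.
Proof. by apply/measurable_EFinP; exact: measurable_int iw. Qed.

Lemma measurable_weighted :
  measurable_fun setT (fun xy : Omega * Y => w xy.2 * phi xy).
Proof. by apply: measurable_funM => //; exact: measurableT_comp. Qed.

Lemma weightedE y : \forall x \ae rho,
  (w y *: Phi y : LspaceType rho q1) x = w y * phi (x, y).
Proof.
by apply: filterS2 (PhiE y) (LspaceZE (w y) (Phi y)) => x <- /(_ I) ->.
Qed.

Lemma weighted_norm_le :
  (\int[mu]_y `|w y *: Phi y|%:E <= (\int[mu]_y `|w y|%:E) * M%:E)%E.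
Proof.
have mn : measurable_fun setT (fun y => `|w y *: Phi y|).
  exact: measurable_norm_section measurable_weighted _ weightedE.
have mnw : measurable_fun setT (fun y => `|w y|%:E).
  by apply/measurable_EFinP; exact: measurableT_comp.
have [M0|M0] := leP 0 M.
  rewrite -ge0_integralZr//.
  apply: ae_ge0_le_integral => //.
  - exact/measurable_EFinP.
  - by move=> y _; rewrite mule_ge0.
  - exact: emeasurable_funM.
  by apply: filterS PhiM => y My _; rewrite normrZ lee_fin ler_wpM2l.
(* A negative [M] bounds norms a.e. only if [mu] is the zero measure, and then both sides are
   zero. *)
have ae0 : \forall y \ae mu, False.
  by apply: filterS PhiM => y; rewrite leNgt (lt_le_trans M0).
have I0 (f : Y -> \bar R) : measurable_fun setT f -> (forall y, 0 <= f y)%E ->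
    (\int[mu]_y f y = 0)%E.
  move=> mf f0; rewrite (@ge0_ae_eq_integral _ _ _ mu setT _ (cst 0%E)) ?integral0//.
  exact: filterS ae0.
by rewrite !I0 ?mul0e//; exact/measurable_EFinP.
Qed.

Hypothesis Psioo : (\int[mu]_y `|w y *: Phi y|%:E < +oo)%E.
Variable hf : (fun x => \int[mu]_y (w y * phi (x, y))) \in Lfun rho q%:E.

(** Replace [Phi] by its nearest points [c k] in a sequence dense in [G]. Weighting the values by
    the integrals of [w] over their level sets gives [l] times a hull point, and the error, the
    integral of [|w| * |c k - Phi|], tends to zero by domination by [|w| * M]. *)
Lemma variation_ball_Lclass (G : set X) (l : R) : G !=set0 ->
  (\forall y \ae mu, G (Phi y)) -> 0 < l -> \int[mu]_y `|w y| <= l ->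
  variation_ball G (l^-1 *: (Lclass q1 hf : X)).
Proof.
move=> G0 aeG l0 Wl; apply/variation_ballP => eps eps0.
have [e eG ed] := separable_subset_seq sX G0.
have mdist := measurable_dist_section mphi PhiE.
pose c k y := nearest e k (Phi y).
have iwM : mu.-integrable setT (fun y => (`|w y| * M)%:E).
  under eq_fun do rewrite EFinM.
  by apply: integrableZr => //; exact: integrable_norm.
have : (\int[mu]_y (`|w y| * `|c k y - Phi y|)%:E)%E @[k --> \oo] --> 0%E.
  have [] := @dominated_convergence _ _ _ mu setT measurableT
    (fun k y => (`|w y| * `|c k y - Phi y|)%:E) (cst 0%E) _ _ _ _ iwM _ => //.
  - move=> k; apply/measurable_EFinP; apply: measurable_funM.
      exact: measurableT_comp.
    exact: measurable_nearest_dist.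
  - apply: filterS aeG => y Gy _; apply: cvg_EFin; first exact: nearW.
    rewrite -[X in _ --> X](mulr0 `|w y|); apply: cvgMr.
    rewrite -[X in _ --> X](@normr0 _ X); apply: cvg_norm; apply/subr_cvg0.
    by apply: nearest_cvg => ? ?; exact: ed.
  - apply: filterS PhiM => y My k _ /=.
    rewrite lee_fin ger0_norm ?mulr_ge0// ler_wpM2l//.
    exact: le_trans (nearest_dist_le _ _ _) My.
  - by move=> _ _; rewrite integral0.
(* The final division by [l] turns an error below [eps * l] into one below [eps]. *)
have le0 : 0 < eps * l by rewrite mulr_gt0.
move=> /fine_cvgP[sfin /cvgrPdist_lt/(_ _ le0) slt].
have [k [kfin klt]] : exists k,
    (\int[mu]_y (`|w y| * `|c k y - Phi y|)%:E)%E \is a fin_num /\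
    `|0 - fine (\int[mu]_y (`|w y| * `|c k y - Phi y|)%:E)%E| < eps * l.
  by have [k [? ?]] := @filter_ex _ _ _ _ (filterI sfin slt); exists k.
have fc : finite_set (range (c k) `\ 0).
  by apply: sub_finite_set (finite_range_nearest e k Phi) => v [].
have [ic sc] := sum_normr_Rintegral_level_le iw fc
  (fun v => measurable_nearest e mdist k [set v]).
pose a v := \int[mu]_y (w y * (c k y == v)%:R).
have [||z hz az] := @signed_fsum_hull _ X G l _ a G0 fc.
(* The value [0] of [nearest] need not lie in [G], but it is left out of the sum; the other values
   are terms of [e]. *)
- move=> v [[y _ <-] /=].
  by rewrite /c; have [->|[i ->]] := nearest_range e k (Phi y).
- exact: le_trans sc Wl.
exists z => //.
have lz : l^-1 *: (Lclass q1 hf : X) - z = l^-1 *: ((Lclass q1 hf : X) - l *: z).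
  by rewrite scalerBr scalerA mulVf ?gt_eqF// scale1r.
rewrite lz normrZ gtr0_norm ?invr_gt0// mulrC ltr_pdivrMr// -lte_fin -az.
have := norm_Lclass_Rintegral_sub_level measurable_weighted weightedE Psioo
  hf fc (fun v _ => ic v).
move=> /le_lt_trans; apply.
under eq_integral do rewrite -scalerBr normrZ distrC.
rewrite -(fineK kfin) lte_fin (le_lt_trans (ler_norm _))//.
by rewrite -normrN -sub0r.
Qed.

End weighted.

(** * The essential supremum norm *)

Section Linfty_norm.
Context {R : realType} (X : normedModType R) d (Y : measurableType d).
Variables (mu : {measure set Y -> \bar R}) (h : Y -> X).

Lemma ae_le_Linfty_norm : \forall y \ae mu, (`|h y|%:E <= Linfty_norm mu h)%E.
Proof.
have le_ess : (ess_sup mu (fun y => `|h y|%:E) <= Linfty_norm mu h)%E.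
  apply: ereal_inf_le_tmp => _ [B [_ hB] <-] /=.
  by apply: filterS hB => y; rewrite lee_fin.
apply: filterS (ess_sup_ge mu (fun y => `|h y|%:E)) => y.
by move/le_trans; apply.
Qed.

Lemma Linfty_norm_fin_num (M : R) : (\forall y \ae mu, `|h y| <= M) ->
  Linfty_norm mu h \is a fin_num.
Proof.
move=> hM; rewrite ge0_fin_numE; last first.
  by apply: le_ereal_inf_tmp => _ [B [B0 _] <-]; rewrite lee_fin.
apply: (@le_lt_trans _ _ `|M|%:E); last exact: ltry.
(* The infimum ranges over nonnegative bounds and [M] may be negative, hence [|M|]. *)
apply: ereal_inf_lbound; exists `|M| => //; split => //.
by apply: filterS hM => y /le_trans; apply; exact: ler_norm.
Qed.

End Linfty_norm.

Theorem theorem5p1 (R : realType) (dO dY : measure_display)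
    (Omega : measurableType dO) (Y : measurableType dY)
    (rho : {sigma_finite_measure set Omega -> \bar R})
    (mu : {sigma_finite_measure set Y -> \bar R})
    (w : Y -> R) (w_L1 : w \in Lfun mu 1%E)
    (q : R) (q1 : (1 <= q%:E)%E)
    (X_separable : separable (LspaceType rho q1))
    (phi : Omega * Y -> R) (phi_meas : measurable_fun [set: Omega * Y] phi)
    (Phi : Y -> LspaceType rho q1)
    (PhiE : forall y, \forall x \ae rho, (Phi y : Omega -> R) x = phi (x, y))
    (M : R) (PhiM : \forall y \ae mu, `|Phi y| <= M) :
  let X : normedModType R := LspaceType rho q1 in
  let f : Omega -> R := fun x => \int[mu]_y (w y * phi (x, y)) in
  let norm_w : \bar R := ('N[mu]_1[EFin \o w])%E in
  (\forall x \ae rho,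
      mu.-integrable [set: Y] (fun y => (w y * phi (x, y))%:E)) /\
  exists f_Lq : f \in Lfun rho q%:E,
  let F : X := Lclass q1 f_Lq in
  (`|F|%:E <= norm_w * M%:E)%E /\
  (Borel_measurable Phi /\ in_Linfty mu Phi /\
   is_Bochner_integral mu (fun y => w y *: Phi y) F) /\
  let G : set X :=
    [set Phi y | y in [set y | (`|Phi y|%:E <= Linfty_norm mu Phi)%E]] in
  (G !=set0 ->
   [/\ variation_space G F,
       (variation_norm G F <= norm_w)%E,
       (`|F|%:E <= variation_norm G F * variation_sup G)%E &
       (variation_norm G F * variation_sup G <=
          norm_w * Linfty_norm mu Phi)%E]).
Proof.
move=> X f norm_w.
have iw : mu.-integrable setT (EFin \o w) := (Lfun1_integrable mu w).1 w_L1.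
have inw := integrable_norm iw.
have norm_wE : norm_w = (\int[mu]_y `|w y|%:E)%E by rewrite /norm_w Lnorm1.
have wfin : norm_w \is a fin_num.
  by rewrite norm_wE; exact: integrable_fin_num.
have mpsi := measurable_weighted iw phi_meas.
have psiE := weightedE w PhiE.
have le_psi := weighted_norm_le iw phi_meas PhiE PhiM.
rewrite -norm_wE in le_psi.
have psioo : (\int[mu]_y `|w y *: Phi y|%:E < +oo)%E.
  by apply: le_lt_trans le_psi _; rewrite -(fineK wfin) -EFinM ltry.
split; first exact: (ae_integrable_Lq_section mpsi psiE psioo).
have f_Lq : f \in Lfun rho q%:E := Rintegral_section_Lfun mpsi psiE psioo.
exists f_Lq => F.
have mdist := measurable_dist_section phi_meas PhiE.
split.
  exact: le_trans (norm_Lclass_Rintegral_le mpsi psiE f_Lq) le_psi.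
split.
  split.
    have [e _ ed] := separable_subset_seq X_separable (ex_intro setT 0 I).
    move=> U; apply: (measurable_preimage_dense mdist) => v eps.
    exact: ed.
  split.
    split; last by exists M.
    exact: separable_strongly_measurable.
  exact: (is_Bochner_integral_Lclass mpsi psiE psioo f_Lq X_separable).
move=> G G0.
have Lfin := Linfty_norm_fin_num PhiM.
rewrite norm_wE.
have -> : (\int[mu]_y `|w y|%:E)%E = (\int[mu]_y `|w y|)%:E.
  by rewrite /Rintegral fineK -?norm_wE.
rewrite -(fineK Lfin); apply: variation_bounds => //.
- by apply: Rintegral_ge0.
- by move=> _ [y yL <-]; rewrite -lee_fin (fineK Lfin); exact: yL.
(* Almost every value of [Phi] lies in [G], so approximating [Phi] by points of [G] costs nothing in
   the integral. *)
have aeG : \forall y \ae mu, G (Phi y).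
  by apply: filterS (ae_le_Linfty_norm mu Phi) => y yL; exists y.
move=> l l0 Wl.
exact: (variation_ball_Lclass X_separable iw phi_meas PhiE PhiM psioo
  G0 aeG l0 Wl).
Qed.
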